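(* Let $k\ge2$. (1) For any two elements $\varphi,\psi\in M_{k,1}$ with $\varphi\equiv_{\mathcal R}\psi$ and $\varphi>_{\mathcal L}\psi$, there exists $\chi\in M_{k,1}$ such that $\varphi\equiv_{\mathcal R}\chi\equiv_{\mathcal R}\psi$ and $\varphi>_{\mathcal L}\chi>_{\mathcal L}\psi$. (2) For every $\varphi\in M_{k,1}\setminus\{\mathbf 0\}$ there exists $\chi\in M_{k,1}$ such that $\chi\equiv_{\mathcal R}\varphi$ and $\varphi>_{\mathcal L}\chi$. And for every $\psi\in M_{k,1}$ such that $\psi$ is not $\mathcal L$-maximal, there exists $\chi\in M_{k,1}$ such that $\chi\equiv_{\mathcal R}\psi$ and $\chi>_{\mathcal L}\psi$.
   Context: $A$ is an alphabet with $k\ge2$ letters, $A^*$ the free monoid over $A$. A right ideal of $A^*$ is a set $R\subseteq A^*$ with $RA^*\subseteq R$. A right ideal homomorphism is a function $\varphi$ whose domain ${\sf Dom}(\varphi)\subseteq A^*$ is a right ideal, with values in $A^*$ and $\varphi(xw)=\varphi(x)w$ for all $x\in{\sf Dom}(\varphi)$, $w\in A^*$. ${\sf riHom}(A^* )$ is the set of right ideal homomorphisms with finitely generated domain. A right ideal $R'\subseteq R$ is essential in the right ideal $R$ iff $R'$ intersects every nonempty right ideal contained in $R$. $\Phi$ is an essentially equal restriction of $\varphi$ (and $\varphi$ an essentially equal extension of $\Phi$) iff $\Phi$ is a restriction of $\varphi$ and ${\sf Dom}(\Phi)$ is essential in ${\sf Dom}(\varphi)$. Every $\varphi\in{\sf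 riHom}(A^* )$ has a unique maximal essentially equal extension $\max(\varphi)$. The Thompson-Higman monoid is $M_{k,1}=\{\max(\varphi):\varphi\in{\sf riHom}(A^* )\}$ with multiplication $\psi\varphi=\max(\psi\circ\varphi)$ (functions act on the left). $\mathbf 0$ is its zero, the empty function. $u\le_{\mathcal R}v$ means $u=vx$, and $u\le_{\mathcal L}v$ means $u=xv$, for some $x\in M_{k,1}$. For $\mathcal K\in\{\mathcal R,\mathcal L\}$: $u\equiv_{\mathcal K}v$ means $u\le_{\mathcal K}v$ and $v\le_{\mathcal K}u$; $v>_{\mathcal K}u$ means $u\le_{\mathcal K}v$ and not $u\equiv_{\mathcal K}v$. An element is $\mathcal L$-maximal iff no element is $>_{\mathcal L}$ it.
   Formalization: In the last clause of (2), ψ is additionally assumed nonzero: the zero is not L-maximal (the identity is strictly L-above it), but its R-class is {0}, so the clause fails at ψ = 0. *)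

(* Defs.v *)
From mathcomp Require Import all_boot.
From mathcomp Require Import boolp classical_sets functions cardinality.

Set Implicit Arguments.
Unset Strict Implicit.
Unset Printing Implicit Defensive.

Local Open Scope classical_set_scope.

Section RightIdeals.
Variable A : finType.

(* The free monoid over A is [seq A] with concatenation. *)
Definition right_ideal (R : set (seq A)) : Prop :=
  forall x w : seq A, R x -> R (x ++ w).

Definition fin_gen (R : set (seq A)) : Prop :=
  exists2 S : set (seq A), finite_set S & R = [set x ++ w | x in S & w in setT].

Definition essential (R' R : set (seq A)) : Prop :=
  R' `<=` R /\
  forall I : set (seq A), right_ideal I -> I !=set0 -> I `<=` R ->
    (R' `&` I) !=set0.

(* Partial functions are option-valued; with the classical axioms, Leibniz
   equality of such functions is equality of graphs. *)
Definition pfun : Type := seq A -> option (seq A).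

Definition Dom (f : pfun) : set (seq A) := [set x | f x != None].

Definition pzero : pfun := fun=> None.

Definition right_ideal_hom (f : pfun) : Prop :=
  right_ideal (Dom f) /\
  forall x y w : seq A, f x = Some y -> f (x ++ w) = Some (y ++ w).

Definition riHom : set pfun :=
  [set f | right_ideal_hom f /\ fin_gen (Dom f)].

Definition restriction (g f : pfun) : Prop :=
  forall x : seq A, Dom g x -> f x = g x.

Definition ee_restriction (g f : pfun) : Prop :=
  restriction g f /\ essential (Dom g) (Dom f).

Definition max_ee_extension (f m : pfun) : Prop :=
  [/\ riHom m, ee_restriction f m &
      forall g : pfun, riHom g -> ee_restriction f g -> restriction m g -> g = m].

Lemma DomP (f : pfun) x : Dom f x <-> exists y, f x = Some y.
Proof.
rewrite /Dom /=; case: (f x) => [y|]; split => //; first by exists y.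
by case.
Qed.

Lemma catI_prefix (u v u' v' : seq A) : u ++ v = u' ++ v' ->
  (exists w, u' = u ++ w) \/ (exists w, u = u' ++ w).
Proof.
move=> e; case: (leqP (size u) (size u')) => h.
  left; exists (drop (size u) u').
  by rewrite -{1}(cat_take_drop (size u) u') -(takel_cat v' h) -e take_size_cat.
right; exists (drop (size u') u).
by rewrite -{1}(cat_take_drop (size u') u) -(takel_cat v (ltnW h)) e take_size_cat.
Qed.

Lemma right_ideal_principal (x : seq A) : right_ideal [set x ++ w | w in setT].
Proof. by move=> _ w [v _ <-]; exists (v ++ w) => //; rewrite catA. Qed.

Lemma essential_meet R' R x : right_ideal R -> essential R' R -> R x ->
  exists w, R' (x ++ w).
Proof.
move=> rR [_ eR] Rx.
have [||y [R'y [w _ e]]] := eR _ (right_ideal_principal (x := x)).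
- by exists (x ++ [::]); exists [::].
- by move=> _ [w _ <-]; exact: rR.
by exists w; rewrite e.
Qed.

Lemma ee_agree f g h x y z : right_ideal_hom g -> right_ideal_hom h ->
  ee_restriction f g -> ee_restriction f h ->
  g x = Some y -> h x = Some z -> y = z.
Proof.
move=> [rg hg] [rh hh] [fg eg] [fh eh] gx hx.
have [|w fxw] := essential_meet rg eg (x := x); first by apply/DomP; exists y.
have := fh _ fxw; rewrite -(fg _ fxw) (hg _ _ _ gx) (hh _ _ _ hx) => -[e].
have sz : size z = size y.
  by apply/eqP; rewrite -(eqn_add2r (size w)) -!size_cat e.
by move/eqP: e; rewrite eqseq_cat // => /andP[/eqP].
Qed.

(* The union of all essentially equal extensions. *)
Lemma greatest_ee_extension f : riHom f ->
  exists m, [/\ riHom m, ee_restriction f m &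
    forall g, riHom g -> ee_restriction f g -> restriction g m].
Proof.
move=> [hf [S finS DS]].
pose P x y := exists g, [/\ riHom g, ee_restriction f g & g x = Some y].
have Pfun x y z : P x y -> P x z -> y = z.
  by move=> [g [[hg _] eg gx]] [h [[hh _] eh hx]]; exact: (ee_agree hg hh eg eh gx hx).
pose m x := if pselect (exists y, P x y) is left e then Some (projT1 (cid e)) else None.
have mP x y : m x = Some y <-> P x y.
  rewrite /m; case: pselect => [e|ne]; last by split=> // p; case: ne; exists y.
  case: cid => z Pz /=; split=> [[<-]//|p]; by rewrite (Pfun _ _ _ p Pz).
have ff : ee_restriction f f.
  split=> //; split=> // I rI [x Ix] If; exists x; split=> //; exact: If.
have Pf x y : f x = Some y -> P x y by exists f; split=> //; split=> //; exists S.
have mhom x y w : m x = Some y -> m (x ++ w) = Some (y ++ w).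
  move=> /mP [g [hg eg gx]]; apply/mP; exists g; split=> //.
  by case: hg => -[_ hg] _; exact: hg.
have mri : right_ideal (Dom m).
  by move=> x w /DomP[y /mhom e]; apply/DomP; exists (y ++ w).
have fm : restriction f m by move=> x /DomP[y e]; rewrite e; apply/mP/Pf.
have fmD : Dom f `<=` Dom m.
  by move=> x fx; rewrite /Dom /= fm.
have meet x : Dom m x -> exists w, Dom f (x ++ w).
  move=> /DomP[y /mP[g [[[rg _] _] [_ eg] gx]]].
  by apply: essential_meet rg eg _; apply/DomP; exists y.
exists m; split.
- split=> //.
  exists (Dom m `&` \bigcup_(s in S) [set take i s | i in `I_(size s).+1]).
    by apply: finite_setIr; apply: bigcup_finite => // s _; exact/finite_image/finite_II.
  apply/seteqP; split=> [x mx|_ [x [mx _] [w _ <-]]]; last exact: mri.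
  have [w] := meet _ mx; rewrite DS => -[s Ss [v _ e]].
  case: (catI_prefix e) => [[t ex]|[t es]].
    exists s; last by exists t.
    split; first by apply: fmD; rewrite DS; exists s => //; exists [::]; rewrite ?cats0.
    by exists s => //; exists (size s); rewrite /= ?take_size.
  exists x; last by exists [::]; rewrite ?cats0.
  split=> //; exists s => //; exists (size x); last by rewrite es take_size_cat.
  by rewrite /= es size_cat ltnS leq_addr.
- split=> //; split=> // I rI [x Ix] Im.
  have [w fxw] := meet _ (Im _ Ix); exists (x ++ w); split=> //; exact: rI.
- move=> g hg eg x /DomP[y gx]; rewrite gx; apply/mP; by exists g.
Qed.

Lemma restriction_anti f g : restriction f g -> restriction g f -> f = g.
Proof.
move=> fg gf; apply/funext => x; case fx: (f x) => [y|].
  by rewrite fg //; apply/DomP; exists y.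
by case gx: (g x) => [z|//]; rewrite -gx -gf //; apply/DomP; exists z.
Qed.

Lemma max_ee_extension_ex f : riHom f -> exists m, max_ee_extension f m.
Proof.
move=> /greatest_ee_extension[m [hm em mm]]; exists m; split=> // g hg eg mg.
by apply: restriction_anti => //; exact: mm.
Qed.

Lemma max_ee_extension_uniq f m m' : riHom f ->
  max_ee_extension f m -> max_ee_extension f m' -> m = m'.
Proof.
move=> /greatest_ee_extension[n [hn en nn]] [hm em mm] [hm' em' mm'].
by rewrite -(mm n hn en (nn _ hm em)) (mm' n hn en (nn _ hm' em')).
Qed.

(* Some maximal extension when there is one, the empty function otherwise. *)
Definition rimax (f : pfun) : pfun := xget pzero (max_ee_extension f).

Lemma rimaxP f : riHom f -> max_ee_extension f (rimax f).
Proof. by move=> /max_ee_extension_ex[m hm]; rewrite /rimax; case: xgetP => [_ _ //|/(_ m)]. Qed.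

Lemma riHom_pcomp f g : riHom f -> riHom g -> riHom (pcomp f g).
Proof.
move=> [[rf hf] [S finS DS]] [[rg hg] [T finT DT]].
have hc x y w : pcomp f g x = Some y -> pcomp f g (x ++ w) = Some (y ++ w).
  rewrite /pcomp; case gx: (g x) => [z|//] /= fz.
  by rewrite (hg _ _ _ gx) /= (hf _ _ _ fz).
have rc : right_ideal (Dom (pcomp f g)).
  by move=> x w /DomP[y /hc e]; apply/DomP; exists (y ++ w).
split=> //.
exists (Dom (pcomp f g) `&`
   [set t ++ drop (size (odflt [::] (g t))) s | t in T & s in S]).
  by apply: finite_setIr; apply: finite_image2.
apply/seteqP; split=> [x cx|_ [x [mx _] [w _ <-]]]; last exact: rc.
have /DomP[z] := cx; rewrite /pcomp; case gx: (g x) => [y|//] /= fy.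
have : Dom g x by apply/DomP; exists y.
rewrite DT => -[t Tt [v _ ex]].
have /DomP[u gt] : Dom g t by rewrite DT; exists t => //; exists [::]; rewrite ?cats0.
have ey : y = u ++ v by move: gx; rewrite -ex (hg _ _ _ gt) => -[].
have : Dom f y by apply/DomP; exists z.
rewrite DS => -[s Ss [w _ es]].
have Dfs r : Dom f (s ++ r) by rewrite DS; exists s => //; exists r.
have Dc r q : g r = Some q -> Dom f q -> Dom (pcomp f g) r.
  by rewrite /Dom /pcomp /= => ->.
rewrite ey in es; case: (catI_prefix es) => [[r eu]|[r er]].
  exists t; last by exists v.
  split; first by apply: Dc gt _; rewrite eu.
  exists t => //; exists s => //.
  by rewrite gt /= drop_oversize ?cats0 // eu size_cat leq_addr.
exists (t ++ r).
  split; first by apply: (Dc _ (u ++ r)); rewrite ?(hg _ _ _ gt) // -er -[s]cats0.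
  by exists t => //; exists s => //; rewrite gt /= er drop_size_cat.
exists w => //; rewrite -ex -catA; congr cat.
by move/eqP: es; rewrite er -catA eqseq_cat // eqxx /= => /eqP.
Qed.

(* The Thompson-Higman monoid M_{k,1}, k = #|A|, as a set of partial functions.
   Functions act on the left, so [Mmul psi phi] applies [phi] first. *)
Definition Mk1 : set pfun := [set rimax f | f in riHom].

Definition Mmul (psi phi : pfun) : pfun := rimax (pcomp psi phi).

Lemma Mk1_riHom f : Mk1 f -> riHom f.
Proof. by move=> [g /rimaxP[h _ _] <-]. Qed.

Lemma Mmul_closed f g : Mk1 f -> Mk1 g -> Mk1 (Mmul f g).
Proof.
by move=> /Mk1_riHom hf /Mk1_riHom hg; exists (pcomp f g) => //; exact: riHom_pcomp.
Qed.

Definition R_le (u v : pfun) : Prop := exists2 x, Mk1 x & u = Mmul v x.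
Definition L_le (u v : pfun) : Prop := exists2 x, Mk1 x & u = Mmul x v.

Definition le_equiv (le : pfun -> pfun -> Prop) (u v : pfun) : Prop :=
  le u v /\ le v u.
Definition le_gt (le : pfun -> pfun -> Prop) (v u : pfun) : Prop :=
  le u v /\ ~ le_equiv le u v.

Definition R_equiv : pfun -> pfun -> Prop := le_equiv R_le.
Definition L_gt : pfun -> pfun -> Prop := le_gt L_le.

Definition L_maximal (u : pfun) : Prop := ~ exists2 v, Mk1 v & L_gt v u.

End RightIdeals.

Arguments pzero {A}.

(* Main.v *)
(* Elements of M_{k,1} correspond to maps on words that are right ideal homomorphisms on
   all long words, modulo agreement on all long words.  Every f has a section s, with
   f s = id on Im f.  Hence u <=_R v as soon as Im u is contained in Im v, and u <=_L v as
   soon as u is undefined where v is and u identifies the words that v identifies.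

   If v = x u is strictly L-below u, then the failure of the kernel criterion gives a
   word p in Im u on whose cylinder x is undefined, or whose cylinder x identifies with
   the cylinder of another word p' in Im u.  Fix a letter c0 and let y be the identity
   off p, with y(p c0 w) = p w and, for letters c <> c0, y(p c w) undefined or equal to
   p' c w, respectively.  As y maps Im u onto itself, y u is R-equivalent to u, and it
   lies strictly between u and v because x factors through y on Im u.  Making p w one
   image of p c0 w keeps the image unchanged without any counting modulo k - 1.

   If u is not L-maximal, apply the same criterion to the identity and u: u is
   undefined on a cylinder p, or maps two cylinders p and x to the same cylinder r.
   Squeezing the cylinder r into r c0 and sending p c w to r c w for c <> c0 gives an
   element with the same image strictly L-above u. *)
Require Import Defs.
From mathcomp Require Import all_boot.
From mathcomp Require Import boolp classical_sets functions cardinality.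

Set Implicit Arguments.
Unset Strict Implicit.
Unset Printing Implicit Defensive.

Local Open Scope classical_set_scope.

Section EventualHomomorphisms.
Variable A : finType.
Implicit Types (f g h u v : pfun A) (p q r t w x y : seq A).

(** * Homomorphisms on long words, modulo agreement on long words *)

Definition hom_from N f := forall x w, N <= size x -> f (x ++ w) = omap (cat^~ w) (f x).

Definition ehom f := exists N, hom_from N f.

Definition feq f g := exists N, forall x, N <= size x -> f x = g x.

Definition restrict_long N f : pfun A := fun x => if N <= size x then f x else None.

Lemma feq_sym f g : feq f g -> feq g f.
Proof. by move=> [N e]; exists N => x /e. Qed.

Lemma feq_trans g f h : feq f g -> feq g h -> feq f h.
Proof.
move=> [N e] [M e']; exists (maxn N M) => x; rewrite geq_max => /andP[Nx Mx].
by rewrite e // e'.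
Qed.

Lemma hom_fromW N M f : N <= M -> hom_from N f -> hom_from M f.
Proof. by move=> NM hf x w /(leq_trans NM); exact: hf. Qed.

Lemma ehom_Some : ehom (@Some (seq A)). Proof. by exists 0. Qed.

Lemma ehom_pzero : ehom (@pzero A). Proof. by exists 0. Qed.

Lemma ehom_cat p : ehom (fun w => Some (p ++ w)).
Proof. by exists 0 => x w _ /=; rewrite catA. Qed.

(** Letters beyond position [N] are copied to the end of the value, so long words have long
    values. *)
Lemma hom_from_size N K f x y :
  hom_from N f -> N + K <= size x -> f x = Some y -> K <= size y.
Proof.
move=> hf le; rewrite -{1}(cat_take_drop N x) hf; last first.
  by rewrite size_takel // (leq_trans _ le) // leq_addr.
case: (f _) => [z|//] [<-] /=; rewrite size_cat size_drop.
by apply: leq_trans (leq_addl _ _); rewrite leq_subRL ?(leq_trans _ le) ?leq_addr.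
Qed.

Lemma ehom_pcomp f g : ehom f -> ehom g -> ehom (pcomp f g).
Proof.
move=> [N hf] [M hg]; exists (M + N) => x w le.
rewrite /pcomp hg; last exact: leq_trans (leq_addr _ _) le.
case gx: (g x) => [y|//] /=; exact/hf/(hom_from_size hg le gx).
Qed.

Lemma feq_pcompl f f' g : ehom g -> feq f f' -> feq (pcomp f g) (pcomp f' g).
Proof.
move=> [M hg] [N e]; exists (M + N) => x le; rewrite /pcomp.
case gx: (g x) => [y|//] /=; exact/e/(hom_from_size hg le gx).
Qed.

Lemma feq_pcompr f g g' : feq g g' -> feq (pcomp f g) (pcomp f g').
Proof. by move=> [N e]; exists N => x le; rewrite /pcomp e. Qed.

Lemma pcompA f g h : pcomp f (pcomp g h) = pcomp (pcomp f g) h.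
Proof. by apply/funext => x; rewrite /pcomp; case: (h x). Qed.

(** * Finite generation as a length bound *)

Lemma finite_words N : finite_set [set x : seq A | size x <= N].
Proof.
apply: (@sub_finite_set _ _ ((fun b : N.-bseq A => val b) @` [set` predT])).
  move=> x /= le; exists (Bseq le) => //.
exact/finite_image/finite_finpred.
Qed.

Lemma fin_gen_take (D : set (seq A)) N :
  right_ideal D -> (forall x, D x -> D (take N x)) -> fin_gen D.
Proof.
move=> rD DN; exists (D `&` [set x | size x <= N]).
  by apply: finite_setIr; exact: finite_words.
apply/seteqP; split=> [x Dx|_ [x [Dx _] [w _ <-]]]; last exact: rD.
exists (take N x); last by exists (drop N x); rewrite ?cat_take_drop.
by split; [exact: DN|rewrite /= size_take_min geq_minl].
Qed.

Lemma fin_gen_bound (D : set (seq A)) : fin_gen D ->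
  exists N, forall x, D x -> D (take N x).
Proof.
move=> [S finS DS].
have [s eS] : exists s : seq (seq A), S = [set` s].
  by have /finite_seqP := finS.
exists (\max_(i <- s) size i) => x; rewrite DS => -[t St [w _ <-]].
exists t => //; exists (take (\max_(i <- s) size i - size t) w) => //.
rewrite take_cat ltnNge.
by have -> : size t <= \max_(i <- s) size i by apply: leq_bigmax_seq => //; rewrite eS in St.
Qed.

(** Finite generation handles undefined values: if a continuation of a long [x] is in the domain, so
    is its bounded prefix, hence [x]. *)
Lemma riHom_ehom f : riHom f -> ehom f.
Proof.
move=> [[rf hf] /fin_gen_bound[N DN]]; exists N => x w Nx.
case fx: (f x) => [y|] /=; first exact: hf.
case fxw: (f (x ++ w)) => [z|//].
have /DN : Dom f (x ++ w) by rewrite /Dom /= fxw.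
rewrite takel_cat // => Dx; have := rf _ (drop N x) Dx.
by rewrite cat_take_drop /Dom /= fx.
Qed.

Lemma restrict_long_riHom N f : hom_from N f -> riHom (restrict_long N f).
Proof.
move=> hf.
have hm x y w : restrict_long N f x = Some y -> restrict_long N f (x ++ w) = Some (y ++ w).
  rewrite /restrict_long; case: leqP => // Nx fx.
  by rewrite size_cat (leq_trans Nx (leq_addr _ _)) hf // fx.
have rm : right_ideal (Dom (restrict_long N f)).
  by move=> x w /DomP[y /hm e]; apply/DomP; exists (y ++ w).
split=> //; apply: (@fin_gen_take _ N) => // x; rewrite /Dom /= /restrict_long.
case: leqP => // Nx; rewrite size_takel // leqnn -{1}(cat_take_drop N x) hf ?size_takel //.
by case: (f _).
Qed.

Lemma feq_restrict_long N f : feq (restrict_long N f) f.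
Proof. by exists N => x; rewrite /restrict_long => ->. Qed.

(** * Maximal extensions versus eventual equality *)

Lemma ee_restriction_feq f m : riHom f -> riHom m -> ee_restriction f m -> feq f m.
Proof.
move=> hf hm [fm efm]; have [N DN] := fin_gen_bound hf.2; exists N => x Nx.
case mx: (m x) => [y|].
  have [|w fxw] := essential_meet hm.1.1 efm (x := x); first by apply/DomP; exists y.
  (* A generator met in the cylinder of [x] is already a prefix of [x]. *)
  have := DN _ fxw; rewrite takel_cat // => Dx.
  by rewrite -mx fm // -[x](cat_take_drop N); exact: hf.1.1.
case fx: (f x) => [z|//].
by rewrite -fx -fm // /Dom /= fx.
Qed.

Lemma rimax_ee_restriction h f : riHom h -> riHom f -> ee_restriction h f -> rimax h = rimax f.
Proof.
move=> hh hf [hf1 [hf2 hf3]]; have [hm [fm1 [fm2 fm3]] mm] := rimaxP hf.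
apply: max_ee_extension_uniq (rimaxP hh) _ => //.
have ext g1 g2 x : restriction g1 g2 -> Dom g1 x -> Dom g2 x.
  by move=> r gx; rewrite /Dom /= r.
split=> // [|g hg [hg1 [hg2 hg3]] mg].
  split=> [x hx|]; first by rewrite fm1 ?hf1 //; exact: hf2.
  split=> [x /hf2/fm2//|I rI I0 Im].
  have [x [fx Ix]] := fm3 _ rI I0 Im.
  have [w hw] := essential_meet hf.1.1 (conj hf2 hf3) fx.
  by exists (x ++ w); split=> //; exact: rI.
apply: mm => //; split=> [x fx|].
  by rewrite mg ?fm1 //; exact: fm2.
split=> [x /fm2|I rI I0 Ig]; first exact: ext.
by have [x [hx Ix]] := hg3 _ rI I0 Ig; exists x; split=> //; exact: hf2.
Qed.

Variables c0 c1 : A.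
Hypothesis c10 : c1 != c0.

(** Cutting down to long words gives one common restriction of [f] and [g]; it is essential because
    words can be padded with [c0]. *)
Lemma rimax_feq f g : riHom f -> riHom g -> feq f g -> rimax f = rimax g.
Proof.
move=> hf hg [N e].
have [M hM] := riHom_ehom hf; pose L := maxn N M.
have hh : riHom (restrict_long L f).
  by apply/restrict_long_riHom/hom_fromW/hM; exact: leq_maxr.
have long g' : riHom g' -> (forall x, L <= size x -> f x = g' x) ->
    ee_restriction (restrict_long L f) g'.
  move=> hg' e'; split=> [x|]; rewrite /Dom /= /restrict_long.
    by case: ifP => // /e' ->.
  split=> [x /=|I rI [x Ix] Ig]; first by case: ifP => // /e' ->.
  have Lw : L <= size (x ++ nseq L c0) by rewrite size_cat size_nseq leq_addl.
  exists (x ++ nseq L c0); split; last exact: rI.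
  by rewrite /= Lw e' //; exact/Ig/rI.
rewrite -(rimax_ee_restriction hh hf) ?(rimax_ee_restriction hh hg) //; apply: long => // x.
by move=> /(leq_trans (leq_maxl _ _)); exact: e.
Qed.

Lemma rimax_feqE f : riHom f -> feq f (rimax f).
Proof. by move=> hf; have [hm em _] := rimaxP hf; exact: ee_restriction_feq. Qed.

Lemma Mk1_rimax u f : Mk1 u -> riHom f -> feq u f -> u = rimax f.
Proof.
move=> [g hg <-] hf /(feq_trans (rimax_feqE hg)); exact: rimax_feq.
Qed.

Lemma ehom_Mk1 f : ehom f -> exists2 m, Mk1 m & feq m f.
Proof.
move=> [N /restrict_long_riHom h]; exists (rimax (restrict_long N f)).
  by exists (restrict_long N f).
exact: feq_trans (feq_sym (rimax_feqE h)) (feq_restrict_long _ _).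
Qed.

Lemma Mk1_ehom u : Mk1 u -> ehom u.
Proof. by move=> /Mk1_riHom/riHom_ehom. Qed.

(** * Image and kernel criteria for the Green preorders *)

Lemma R_leP u v : Mk1 u -> Mk1 v ->
  R_le u v <-> exists2 x, ehom x & feq u (pcomp v x).
Proof.
move=> hu hv; split=> [[x hx ->]|[x /ehom_Mk1[m hm mx] ux]].
  exists x; first exact: Mk1_ehom.
  by apply/feq_sym/rimax_feqE/riHom_pcomp; exact: Mk1_riHom.
exists m => //; apply: Mk1_rimax => //; first by apply: riHom_pcomp; exact: Mk1_riHom.
exact: feq_trans ux (feq_pcompr _ (feq_sym mx)).
Qed.

Lemma L_leP u v : Mk1 u -> Mk1 v ->
  L_le u v <-> exists2 x, ehom x & feq u (pcomp x v).
Proof.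
move=> hu hv; split=> [[x hx ->]|[x /ehom_Mk1[m hm mx] ux]].
  exists x; first exact: Mk1_ehom.
  by apply/feq_sym/rimax_feqE/riHom_pcomp; exact: Mk1_riHom.
exists m => //; apply: Mk1_rimax => //; first by apply: riHom_pcomp; exact: Mk1_riHom.
by apply: feq_trans ux (feq_pcompl _ (feq_sym mx)); exact: Mk1_ehom.
Qed.

(** [s] chooses a preimage of [take K q] and copies the rest of [q], so it is a homomorphism on long
    words. *)
Lemma riHom_section f : riHom f -> exists s K, ehom s /\
  forall x q, K <= size q -> f x = Some q -> exists2 x', s q = Some x' & f x' = Some q.
Proof.
move=> [[rf hf] /fin_gen_bound[N DN]].
(* [K] bounds the values on the domain words of length at most [N], which generate the domain; the
   default [[::]] adds nothing. *)
pose K := \max_(b : N.-bseq A) size (odflt [::] (f b)).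
have imK x q : K <= size q -> f x = Some q -> exists x', f x' = Some (take K q).
  move=> Kq fx; have : Dom f (take N x) by apply: DN; apply/DomP; exists q.
  have le : size (take N x) <= N by rewrite size_take_min geq_minl.
  move=> /DomP[y fy]; have yK : size y <= K.
    have := leq_bigmax (F := fun b : N.-bseq A => size (odflt [::] (f b))) (Bseq le).
    by rewrite /= fy.
  move: fx; rewrite -(cat_take_drop N x) (hf _ _ _ fy) => -[<-].
  exists (take N x ++ take (K - size y) (drop N x)).
  by rewrite (hf _ _ _ fy) take_cat ltnNge yK.
pose s q := if pselect (exists x, f x = Some (take K q)) is left e
            then Some (projT1 (cid e) ++ drop K q) else None.
exists s, K; split=> [|x q Kq fx].
  exists K => q w Kq; rewrite /s takel_cat // drop_cat.
  case: pselect => // e /=; congr Some; rewrite -catA; congr cat.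
  case: ltngtP Kq => // -> _; by rewrite subnn drop0 drop_size.
rewrite /s; case: pselect => [e|[]]; last exact: imK fx.
case: cid => x' /= fx'; exists (x' ++ drop K q) => //.
by rewrite (hf _ _ _ fx') cat_take_drop.
Qed.

Lemma R_le_image u v K : Mk1 u -> Mk1 v ->
  (forall x q, K <= size x -> u x = Some q -> exists x', v x' = Some q) -> R_le u v.
Proof.
move=> hu hv im; have [s [L [hs sv]]] := riHom_section (Mk1_riHom hv).
have [M hM] := Mk1_ehom hu; apply/R_leP => //; exists (pcomp s u).
  exact/ehom_pcomp/Mk1_ehom.
exists (maxn K (M + L)) => x; rewrite geq_max => /andP[Kx Mx]; rewrite /pcomp.
case ux: (u x) => [q|//] /=; have [x' vx'] := im _ _ Kx ux.
by have [x'' -> /= ->] := sv _ _ (hom_from_size hM Mx ux) vx'.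
Qed.

Lemma not_L_leP u v K : Mk1 u -> Mk1 v -> ~ L_le u v ->
  (exists x q, [/\ K <= size x, v x = None & u x = Some q]) \/
  (exists x x' q, [/\ K <= size x, K <= size x', v x = Some q, v x' = Some q & u x <> u x']).
Proof.
move=> hu hv; apply: contra_notP => /not_orP[nD nE]; apply/L_leP => //.
have [s [L [hs sv]]] := riHom_section (Mk1_riHom hv).
have [M hM] := Mk1_ehom hv; have [M' hM'] := hs.
(* [x] and [s (v x)] have the same value under [v]; if [u] does not separate them, [u] is
   [u s v]. *)
exists (pcomp u s); first by apply: ehom_pcomp => //; exact: Mk1_ehom.
exists (maxn K (M + maxn L (M' + K))) => x; rewrite geq_max => /andP[Kx Mx].
rewrite /pcomp; case vx: (v x) => [q|] /=; last first.
  by case ux: (u x) => [q|//]; case: nD; exists x, q.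
have := hom_from_size hM Mx vx; rewrite geq_max => /andP[Lq M'q].
have [x' sq vx'] := sv _ _ Lq vx; rewrite sq /=.
have Kx' := hom_from_size hM' M'q sq.
by apply: contrapT => ne; case: nE; exists x, x', q.
Qed.

(** One suffix serves all words, so eventual equality can be tested at chosen short words. *)
Lemma feq_cat f g : feq f g -> exists w, forall t, f (t ++ w) = g (t ++ w).
Proof.
by move=> [N e]; exists (nseq N c0) => t; apply: e; rewrite size_cat size_nseq leq_addl.
Qed.

(** * Incomparable words and maps built on cylinders *)

Definition incomparable p q := ~~ prefix p q && ~~ prefix q p.

Lemma incomparable_cat p q w : incomparable p q -> ~~ prefix p (q ++ w).
Proof.
move=> /andP[pq qp]; apply/negP => /prefixP[v e]; have := catI_prefix e.
by case=> -[t et]; move: pq qp; rewrite et ?prefix_prefix.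
Qed.

Lemma incomparable_neq p q w w' : incomparable p q -> p ++ w <> q ++ w'.
Proof. by move=> /(incomparable_cat w') /negP npq e; apply: npq; rewrite -e prefix_prefix. Qed.

Lemma hom_from_incomparable N f p q r : hom_from N f -> N <= size p -> N <= size q ->
  f p = Some r -> f q = Some r -> p <> q -> incomparable p q.
Proof.
move=> hf Np Nq fp fq npq; apply/andP; split; apply/negP => /prefixP[w e]; apply: npq.
  move: fq; rewrite e hf // fp /= => -[/eqP].
  by rewrite -{2}[r]cats0 eqseq_cat // eqxx /= => /eqP ->; rewrite cats0.
move: fp; rewrite e hf // fq /= => -[/eqP].
by rewrite -{2}[r]cats0 eqseq_cat // eqxx /= => /eqP ->; rewrite cats0.
Qed.

Definition graft p f g : pfun A := fun t => if prefix p t then f (drop (size p) t) else g t.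

Lemma graft_cat p f g w : graft p f g (p ++ w) = f w.
Proof. by rewrite /graft prefix_prefix drop_size_cat. Qed.

Lemma graftN p f g t : ~~ prefix p t -> graft p f g t = g t.
Proof. by rewrite /graft => /negbTE ->. Qed.

Lemma ehom_graft p f g : ehom f -> ehom g -> ehom (graft p f g).
Proof.
move=> [N hf] [M hg]; exists (maxn M (size p + N)) => x w.
rewrite geq_max => /andP[Mx px].
have sx : size p <= size x by apply: leq_trans px; exact: leq_addr.
rewrite /graft !prefixE takel_cat //; case: ifP => _; last exact: hg.
rewrite drop_cat; case: ltngtP sx => // [_ _|e _].
  by rewrite hf // size_drop leq_subRL ?(leq_trans _ px) ?leq_addr.
(* Boundary case: [x] is as long as [p], so [N = 0] and [f] is a homomorphism even at the empty
   word. *)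
rewrite e subnn drop0 drop_size; move: px; rewrite -e -{2}[size p]addn0 leq_add2l leqn0.
by move=> /eqP N0; rewrite -hf ?N0.
Qed.

(** Inside [graft], this splits a cylinder by its next letter; the value at the empty word is
    immaterial, as only long words count. *)
Definition head_case c f g : pfun A := fun w =>
  if w is c' :: w' then if c' == c then f w' else g w else None.

Lemma ehom_head_case c f g : ehom f -> ehom g -> ehom (head_case c f g).
Proof.
move=> [N hf] [M hg]; exists (maxn M N).+1 => -[//|c' x] w /=.
rewrite ltnS geq_max => /andP[Mx Nx]; case: ifP => _; first exact: hf.
by rewrite -cat_cons hg //= (leq_trans Mx).
Qed.

(* The map y of the introduction, with c = c0; b selects the variant that uses p'. *)
Definition strip c p p' (b : bool) : pfun A :=
  graft p (head_case c (fun w => Some (p ++ w)) (fun w => if b then Some (p' ++ w) else None))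
          (@Some _).

Lemma ehom_strip c p p' b : ehom (strip c p p' b).
Proof.
apply/ehom_graft/ehom_Some/ehom_head_case; first exact: ehom_cat.
by case: b; [exact: ehom_cat|exact: ehom_pzero].
Qed.

Lemma strip_hd c p p' b w : strip c p p' b (p ++ c :: w) = Some (p ++ w).
Proof. by rewrite /strip graft_cat /= eqxx. Qed.

Lemma strip_other c p p' b c' w : c' != c ->
  strip c p p' b (p ++ c' :: w) = if b then Some (p' ++ c' :: w) else None.
Proof. by rewrite /strip graft_cat /= => /negbTE ->. Qed.

Lemma stripN c p p' b t : ~~ prefix p t -> strip c p p' b t = Some t.
Proof. exact: graftN. Qed.

(** * Going strictly L-down inside an R-class *)

Lemma long_prefix p t : size p < size t -> prefix p t -> exists c w, t = p ++ c :: w.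
Proof.
move=> lt /prefixP[[|c w] e]; last by exists c, w.
by rewrite e cats0 ltnn in lt.
Qed.

(** Strictness shows after [c1]: there [v] loses the cylinder of [p] or glues it to that of [p'],
    which no left factor can undo. *)
Lemma L_gt_strip u p p' x x' (b : bool) : Mk1 u -> u x = Some p -> u x' = Some p' ->
  (b -> incomparable p p') ->
  exists v, [/\ Mk1 v, feq v (pcomp (strip c0 p p' b) u), R_equiv v u & L_gt u v].
Proof.
move=> hu ux ux' pp'; have eu := Mk1_ehom hu; have [N hN] := eu.
have [_ hom] := (Mk1_riHom hu).1.
have [v hv fv] := ehom_Mk1 (ehom_pcomp (ehom_strip c0 p p' b) eu).
exists v; split=> //.
  have [M eM] := fv; split.
    (* The successor makes values longer than [p], so a letter follows [p]. *)
    apply: (@R_le_image _ _ (maxn M (N + (size p).+1))) => // t q.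
    rewrite geq_max => /andP[Mt Nt]; rewrite eM // /pcomp.
    case ut: (u t) => [r|//] /=; have lr := hom_from_size hN Nt ut.
    have [pr|npr] := boolP (prefix p r); last by rewrite stripN // => -[<-]; exists t.
    have [c [w er]] := long_prefix lr pr; rewrite er.
    have [->|cc0] := eqVneq c c0; first by rewrite strip_hd => -[<-]; exists (x ++ w); exact: hom.
    rewrite strip_other //; case: (b) => // -[<-].
    by exists (x' ++ c :: w); exact: hom.
  apply: (@R_le_image _ _ (maxn M (N + (size p + M)))) => // t r.
  rewrite geq_max => /andP[Mt Nt] ut; have lr := hom_from_size hN Nt ut.
  have [/prefixP[w er]|npr] := boolP (prefix p r); last first.
    by exists t; rewrite eM // /pcomp ut /= stripN.
  exists (x ++ c0 :: w); rewrite eM ?/pcomp ?(hom _ _ _ ux) /= ?strip_hd ?er //.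
  move: lr; rewrite er !size_cat leq_add2l /= => /leq_trans; apply.
  by rewrite addnS -addSn leq_addl.
have le : L_le v u by apply/L_leP => //; exists (strip c0 p p' b) => //; exact: ehom_strip.
split=> // -[_ /(L_leP hu hv)[y hy /feq_trans/(_ (feq_pcompr y fv))/feq_cat[w uw]]].
have := uw (rcons x c1); have := uw (rcons x' c1); rewrite /pcomp -!cats1 -!catA /=.
rewrite (hom _ _ _ ux) (hom _ _ _ ux') /= strip_other //.
case: b pp' {fv le uw} => //= /(_ isT) pp'.
rewrite stripN ?incomparable_cat //= => <- [].
exact: incomparable_neq.
Qed.

(** * Density inside an R-class *)

Lemma R_le_trans g f h : Mk1 f -> Mk1 g -> Mk1 h -> R_le f g -> R_le g h -> R_le f h.
Proof.
move=> hf hg hh /(R_leP hf hg)[x hx fx] /(R_leP hg hh)[y hy gy].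
apply/R_leP => //; exists (pcomp y x); first exact: ehom_pcomp.
by rewrite pcompA; exact: feq_trans fx (feq_pcompl hx gy).
Qed.

Lemma L_le_trans g f h : Mk1 f -> Mk1 g -> Mk1 h -> L_le f g -> L_le g h -> L_le f h.
Proof.
move=> hf hg hh /(L_leP hf hg)[x hx fx] /(L_leP hg hh)[y hy gy].
apply/L_leP => //; exists (pcomp x y); first exact: ehom_pcomp.
by rewrite -pcompA; exact: feq_trans fx (feq_pcompr x gy).
Qed.

Lemma R_equiv_trans g f h : Mk1 f -> Mk1 g -> Mk1 h ->
  R_equiv f g -> R_equiv g h -> R_equiv f h.
Proof.
by move=> hf hg hh [fg gf] [gh hg']; split; [exact: R_le_trans fg gh|exact: R_le_trans hg' gf].
Qed.

(** The kernel criterion, read on images under [u] that are long enough for [f] to act on their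
    whole cylinders. *)
Lemma not_L_le_collision u v f : Mk1 u -> Mk1 v -> ehom f -> feq v (pcomp f u) -> ~ L_le u v ->
  exists (b : bool) p p' t t', [/\ u t = Some p, u t' = Some p', b -> incomparable p p',
    b -> f p' <> None & forall w, f (p ++ w) = if b then f (p' ++ w) else None].
Proof.
move=> hu hv [N hN] [M eM] nle; have [L hL] := Mk1_ehom hu.
have [[t [p []]]|[t [t' [r []]]]] := not_L_leP (maxn M (L + N)) hu hv nle.
  rewrite geq_max => /andP[Mt Lt]; rewrite eM // /pcomp => vt ut; rewrite ut /= in vt.
  exists false, p, p, t, t; split=> // w.
  by rewrite hN ?vt //; exact: hom_from_size hL Lt ut.
rewrite !geq_max => /andP[Mt Lt] /andP[Mt' Lt']; rewrite !eM // /pcomp.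
case ut: (u t) => [p|//]; case ut': (u t') => [p'|//] /= xp xp' ne.
have Np := hom_from_size hL Lt ut; have Np' := hom_from_size hL Lt' ut'.
exists true, p, p', t, t'; split=> // [_|_|w].
- by apply: (hom_from_incomparable hN Np Np' xp xp') => // e; apply: ne; rewrite e.
- by rewrite xp'.
- by rewrite !hN // xp xp'.
Qed.

Lemma L_gt_dense u v : Mk1 u -> Mk1 v -> R_equiv u v -> L_gt u v ->
  exists z, Mk1 z /\ (R_equiv u z /\ R_equiv z v) /\ (L_gt u z /\ L_gt z v).
Proof.
move=> hu hv Ruv [Lvu nLuv].
have [x hx vx] := (L_leP hv hu).1 Lvu.
have [|b [p [p' [t [t' [ut ut' pp' _ xp]]]]]] := not_L_le_collision hu hv hx vx.
  by move=> Luv; exact: nLuv.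
have [z [hz ez Rzu Luz]] := L_gt_strip hu ut ut' pp'.
have Ruz : R_equiv u z by case: Rzu.
exists z; split=> //; split.
  by split=> //; apply: R_equiv_trans Rzu Ruv.
split=> //.
(* [y] undoes the stripping and then applies [x]: it reads [p w] as [p c0 w]. *)
pose y := graft p (fun w => x (p ++ c0 :: w)) x.
have hy : ehom y.
  apply: ehom_graft => //; have := ehom_pcomp hx (ehom_cat (rcons p c0)).
  by congr ehom; apply/funext => w; rewrite /pcomp /= cat_rcons.
have vz : feq v (pcomp y z).
  apply: feq_trans (feq_pcompr y (feq_sym ez)); apply: feq_trans vx _.
  have [L hL] := Mk1_ehom hu.
  exists (L + (size p).+1) => s Ls; rewrite /pcomp.
  case us: (u s) => [r|//] /=; have lr := hom_from_size hL Ls us.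
  have [pr|npr] := boolP (prefix p r); last by rewrite stripN //= /y graftN.
  have [c [w ->]] := long_prefix lr pr.
  have [->|cc0] := eqVneq c c0; first by rewrite strip_hd /= /y graft_cat.
  rewrite strip_other // xp; case: b pp' {ez xp} => //= /(_ isT) pp'.
  by rewrite /y graftN // incomparable_cat.
split=> [|[_ /(L_leP hz hv)[f hf zf]]]; first by apply/L_leP => //; exists y.
(* If [z] were [f v], then [f y] would fix [z] and hence its right multiple [u]; but [y] gives [p w]
   and [p' c0 w] the same value, or is undefined at [p w]. *)
have [g hg ug] := (R_leP hu hz).1 Ruz.1.
have : feq u (pcomp (pcomp f y) u).
  apply: (feq_trans ug); apply: feq_trans (feq_pcompl hg zf) _.
  apply: feq_trans (feq_pcompl hg (feq_pcompr f vz)) _.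
  by rewrite pcompA -pcompA; exact: feq_pcompr (feq_sym ug).
move=> /feq_cat[w uw]; have [_ hom] := (Mk1_riHom hu).1.
have := uw t; have := uw (t' ++ [:: c0]); rewrite -!catA /= /pcomp.
rewrite (hom _ _ _ ut) (hom _ _ _ ut') /= {2}/y graft_cat xp.
case: b pp' {ez xp} => //= /(_ isT) pp'.
rewrite /y graftN ?incomparable_cat // => <- [].
exact: incomparable_neq.
Qed.

(** * Strictly below and strictly above a nonzero element *)

Lemma pfun_neq0 u : u <> pzero -> exists x p, u x = Some p.
Proof.
move=> u0; apply: contrapT => nu; apply: u0; apply/funext => x.
by case ux: (u x) => [p|//]; case: nu; exists x, p.
Qed.

Lemma L_gt_exists_below u : Mk1 u -> u <> pzero ->
  exists v, Mk1 v /\ R_equiv v u /\ L_gt u v.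
Proof.
move=> hu /pfun_neq0[x [p ux]].
have [|v [hv _ Rvu Luv]] := L_gt_strip (b := false) hu ux ux; first by [].
by exists v.
Qed.

(** Every [v] is [v i], so it lies below [i] and hence below [u]. *)
Lemma L_le_id_maximal i u : Mk1 i -> feq i (@Some _) -> Mk1 u -> L_le i u -> L_maximal u.
Proof.
move=> hi ei hu iu [v hv [uv]]; apply; split=> //.
apply: L_le_trans iu => //; apply/L_leP => //.
exists v; first exact: Mk1_ehom.
exact: feq_sym (feq_pcompr v ei).
Qed.

(** The left factor recovering [u] from [v] is [strip c0 r r b]: it shortens [r c0] to [r], and for
    other letters [c] it keeps or kills the words [r c w]. *)
Lemma L_gt_unstrip u x p r (b : bool) : Mk1 u -> u x = Some r -> incomparable p x ->
  (forall w, u (p ++ w) = if b then Some (r ++ w) else None) ->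
  exists v, Mk1 v /\ R_equiv v u /\ L_gt v u.
Proof.
move=> hu ux px up; have eu := Mk1_ehom hu; have [_ hom] := (Mk1_riHom hu).1.
pose e := graft r (fun w => Some (r ++ c0 :: w)) (@Some _).
have he : ehom e.
  apply: ehom_graft ehom_Some; have := ehom_cat (rcons r c0).
  by congr ehom; apply/funext => w; rewrite cat_rcons.
have eK q : obind (strip c0 r r b) (e q) = Some q.
  rewrite /e; have [/prefixP[w ->]|nrq] := boolP (prefix r q).
    by rewrite graft_cat /= strip_hd.
  by rewrite graftN //= stripN.
pose F := graft p (head_case c0 (fun w => pcomp e u (p ++ c0 :: w)) (fun w => Some (r ++ w)))
  (pcomp e u).
have heu := ehom_pcomp he eu.
have hF : ehom F.
  apply: (ehom_graft p _ heu); apply: ehom_head_case (ehom_cat r).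
  have := ehom_pcomp heu (ehom_cat (rcons p c0)).
  by congr ehom; apply/funext => w; rewrite /(pcomp (pcomp _ _)) /= cat_rcons.
have Fother c w : c != c0 -> F (p ++ c :: w) = Some (r ++ c :: w).
  by move=> cc0; rewrite /F graft_cat /= (negbTE cc0).
have Fcase t : size p < size t ->
    (exists c w, c != c0 /\ t = p ++ c :: w) \/ F t = obind e (u t).
  move=> lt; have [pt|npt] := boolP (prefix p t); last by right; rewrite /F graftN.
  have [c [w ->]] := long_prefix lt pt; have [->|cc0] := eqVneq c c0.
    by right; rewrite /F graft_cat /= eqxx.
  by left; exists c, w.
have Fx w : F (x ++ w) = e (r ++ w).
  by rewrite /F graftN ?incomparable_cat // /pcomp (hom _ _ _ ux).
have [v hv vF] := ehom_Mk1 hF; exists v; split=> //.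
have [M eM] := vF; have [N hN] := eu.
have uv : L_le u v.
  apply/L_leP => //; exists (strip c0 r r b); first exact: ehom_strip.
  exists (maxn M (size p).+1) => t; rewrite geq_max => /andP[Mt pt].
  rewrite /pcomp eM //; have [[c [w [cc0 et]]]|->] := Fcase _ pt.
    by rewrite et Fother //= strip_other // up.
  by case: (u t) => [q|//] /=; rewrite eK.
split; first split.
- apply: (@R_le_image _ _ (maxn M (size p).+1)) => // t q.
  rewrite geq_max => /andP[Mt pt]; rewrite eM //.
  have [[c [w [cc0 ->]]]|->] := Fcase _ pt.
    by rewrite Fother // => -[<-]; exists (x ++ c :: w); exact: hom.
  case ut: (u t) => [s|//] /=; rewrite /e.
  have [/prefixP[w es]|nrs] := boolP (prefix r s).
    by rewrite es graft_cat => -[<-]; exists (x ++ c0 :: w); exact: hom.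
  by rewrite graftN // => -[<-]; exists t.
- apply: (@R_le_image _ _ (maxn (maxn M (size p).+1) (N + (size r + M).+1))) => // t q.
  rewrite !geq_max => /andP[/andP[Mt pt] Nt] ut; have lq := hom_from_size hN Nt ut.
  have lr : size r < size q by apply: leq_ltn_trans lq; exact: leq_addr.
  have [rq|nrq] := boolP (prefix r q); last first.
    exists t; rewrite eM //; have [[c [w [cc0 et]]]|->] := Fcase _ pt.
      move: ut; rewrite et up; case: (b) => // -[eq].
      by rewrite -eq prefix_prefix in nrq.
    by rewrite ut /= /e graftN.
  have [c [w eq]] := long_prefix lr rq.
  have Mw : M <= size w by move: lq; rewrite eq size_cat /= addnS ltnS leq_add2l.
  have [ec|cc0] := eqVneq c c0.
    exists (x ++ w); rewrite eM ?size_cat ?(leq_trans Mw) ?leq_addl // Fx.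
    by rewrite /e graft_cat eq ec.
  exists (p ++ c :: w); rewrite eM ?Fother ?eq //.
  by rewrite size_cat /= (leq_trans Mw) // addnS -addSn leq_addl.
split=> // -[_ /(L_leP hv hu)[y _ /(feq_trans (feq_sym vF))/feq_cat[w ew]]].
have := ew (p ++ [:: c1]); have := ew (x ++ [:: c1]); rewrite /pcomp -!catA /=.
rewrite Fother // Fx (hom _ _ _ ux) up; case: (b) => //= <-.
(* The values of [v] at [p c1 w] and [x c1 w] are [r c1 w] and [r c0 c1 w], of different lengths. *)
rewrite /e graft_cat => -[] /(congr1 size); rewrite !size_cat /= => /eqP.
by rewrite eqn_add2l eqn_leq ltnn andbF.
Qed.

Lemma L_gt_exists_above u : Mk1 u -> u <> pzero -> ~ L_maximal u ->
  exists v, Mk1 v /\ R_equiv v u /\ L_gt v u.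
Proof.
move=> hu /pfun_neq0[x [r ux]] nmax; have [N hN] := Mk1_ehom hu.
have [i hi ei] := ehom_Mk1 ehom_Some.
(* By non-maximality the identity is not L-below [u], so the criterion applies with [f = u]. *)
have [|b [p [p' [_ [_ [_ _ pp' up' up]]]]]] :=
    not_L_le_collision hi hu (Mk1_ehom hu) _ (fun l => nmax (L_le_id_maximal hi ei hu l)).
  exact: feq_sym (feq_pcompr u ei).
have [_ hom] := (Mk1_riHom hu).1.
case: b pp' up' up => [/(_ isT) pp' /(_ isT) + up|_ _ up].
  case up': (u p') => [r'|//] _; apply: (@L_gt_unstrip _ _ p r' true hu up' pp') => w.
  by rewrite up (hom _ _ _ up').
apply: (@L_gt_unstrip _ _ p r false hu ux _ up).
(* [u] is defined on the whole cylinder of [x] and nowhere on that of [p]. *)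
apply/andP; split; apply/negP => /prefixP[w e]; first by rewrite e up in ux.
by have := up [::]; rewrite cats0 e (hom _ _ _ ux).
Qed.

End EventualHomomorphisms.

(* In the last clause psi <> 0 is needed: the zero is not L-maximal (the identity
   lies strictly above it), but it is alone in its R-class. *)
Theorem proposition4p6 (k : nat) (A : finType) (hk : (2 <= k)%N) (hA : #|A| = k) :
  (forall phi psi : pfun A, Mk1 phi -> Mk1 psi ->
     R_equiv phi psi -> L_gt phi psi ->
     exists chi : pfun A,
       Mk1 chi /\
       (R_equiv phi chi /\ R_equiv chi psi) /\
       (L_gt phi chi /\ L_gt chi psi))
  /\
  ((forall phi : pfun A, Mk1 phi -> phi <> pzero ->
      exists chi : pfun A, Mk1 chi /\ R_equiv chi phi /\ L_gt phi chi)
   /\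
   (forall psi : pfun A, Mk1 psi -> psi <> pzero -> ~ L_maximal psi ->
      exists chi : pfun A, Mk1 chi /\ R_equiv chi psi /\ L_gt chi psi)).
Proof.
have /card_gt1P[c1 [c0 [_ _ c10]]] : 1 < #|A| by rewrite hA.
split; first by move=> phi psi hphi hpsi; exact: (L_gt_dense c10).
by split=> phi; [exact: (L_gt_exists_below c10)|exact: (L_gt_exists_above c10)].
Qed.
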